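(* Let $D$ be a link diagram with a marked point $p\in D$. Regarded as a complex over the subring $R'_h=\mathbb{Z}[h^2]$ of $R_h=\mathbb{Z}[h]$, the unreduced $U(1)$-equivariant Khovanov complex $\mathit{CKh}_h(D)$ splits into the direct sum of two copies of the reduced $U(1)$-equivariant Khovanov complex $\widetilde{\mathit{CKh}}_h(D)$ (up to shifts of the quantum grading).
   Context: $R_h=\mathbb{Z}[h]$ with $\deg h=2$; $A_h=R_h[X]/(X^2-hX)$ with $\deg X=2$, and $Y:=X-h$. $A_h$ is a Frobenius $R_h$-algebra with the usual multiplication $m$ and unit $\iota$, counit $\epsilon(1)=0,\ \epsilon(X)=1$, and comultiplication $\Delta(1)=1\otimes X+X\otimes 1-h(1\otimes 1)$, $\Delta(X)=X\otimes X$. For an oriented link diagram $D$ with $n$ crossings ($n_-$ of them negative), $\mathit{CKh}_h(D)$ is the Khovanov complex obtained from $A_h$: to each vertex $v\in\{0,1\}^n$ of the cube of resolutions, whose resolution consists of $k$ circles, one assigns $A_h^{\otimes k}$ (tensor over $R_h$, one factor per circle), placed in homological degree $|v|-n_-$; the differential is the sum over edges of $\pm m$ or $\pm\Delta$ applied to the factors of the merging/splitting circles, with the usual signs making squares anticommute. For $D$ with a marked point $p$, let $C=\mathit{CKh}_h(D)$ and let $C_X\subset C$ (resp. $C_Y\subset C$) be the $R_h$-subcomplex spanned by the elements whose tensor factor on the circle containing $p$ is $X$ (resp. $Y$), the other factors being arbitrary. The complexes $C_X$ and $C_Y$ are isomorphic, and either one, with the quantum grading shifted by $-1$, is called the reduced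 complex $\widetilde{\mathit{CKh}}_h(D)$. *)

(* Defs.v *)
From HB Require Import structures.
From mathcomp Require Import all_boot all_order all_algebra ring.

Set Implicit Arguments.
Unset Strict Implicit.
Unset Printing Implicit Defensive.

Import GRing.Theory.
Local Open Scope ring_scope.

Notation Rh := {poly int}.

Definition h : Rh := 'X.

(* The subring R'_h = Z[h^2]. *)
Definition Rh' (a : Rh) : Prop := exists r : {poly int}, a = r \Po 'X^2.

(* The R_h-basis (1, X) of A_h is indexed by bool: false is 1, true is X.
   [mulA a b c] is the coefficient of X^c in X^a X^b, and [comulA a b c] is the
   coefficient of X^b (x) X^c in Delta(X^a). *)
Definition mulA (a b c : bool) : Rh :=
  if a && b then (if c then h else 0) else (c == a || b)%:R.

Definition comulA (a b c : bool) : Rh :=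
  if a then (b && c)%:R
  else if b (+) c then 1 else if b then 0 else - h.

Lemma rmodp_quadratic (R : comNzRingType) (u : R) (n : nat) : (n <= 2)%N ->
  Pdiv.Ring.rmodp 'X^n ('X^2 - u *: 'X) = if n == 2%N then u *: 'X else 'X^n.
Proof.
have size_uX : (size (u *: 'X) < 3)%N.
  by apply: leq_ltn_trans (size_scale_leq _ _) _; rewrite size_polyX.
have size_q : size ('X^2 - u *: 'X) = 3%N.
  by rewrite size_polyDl ?size_polyXn // size_polyN.
have q_monic : 'X^2 - u *: 'X \is monic.
  by rewrite monicE lead_coefDl ?lead_coefXn // size_polyN size_polyXn.
case: eqP => [-> _|n_neq2 n_le2]; last first.
  rewrite Pdiv.Ring.rmodp_small // size_q size_polyXn.
  by case: n n_neq2 n_le2 => [|[|[|]]].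
have {1}-> : 'X^2 = 1 * ('X^2 - u *: 'X) + u *: 'X by rewrite mul1r subrK.
by rewrite Pdiv.RingMonic.rmodp_addl_mul_small // size_q.
Qed.

Lemma mulA_quotient (a b c : bool) :
  mulA a b c = (Pdiv.Ring.rmodp ('X^a * 'X^b) ('X^2 - h *: 'X))`_c.
Proof.
rewrite -exprD rmodp_quadratic; last by case: a b => [] [].
by case: a b c => [] [] []; rewrite /mulA /= ?coefZ ?coefX ?coefC ?mulr1 ?mulr0.
Qed.

(* Each crossing has four half-edges, numbered counterclockwise starting from
   the incoming half-edge of the under-strand (the planar diagram code
   convention): the under-strand runs from 0 to 2, and the over-strand runs from
   3 to 1 at a positive crossing and from 1 to 3 at a negative one. *)
Definition half_edge (n : nat) : Type := ('I_n * 'I_4)%type.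
HB.instance Definition _ n := Finite.on (half_edge n).

Definition outgoing n (positive : pred 'I_n) (d : half_edge n) : bool :=
  (d.2 == 2%N :> nat) || (d.2 == (if positive d.1 then 1 else 3)%N :> nat).

Definition rotate n (d : half_edge n) : half_edge n := (d.1, ordS d.2).

(* An oriented link diagram, as an oriented 4-valent combinatorial map: [glue]
   exchanges the two half-edges of an edge.  Components without crossings are
   only counted.  The orbits of [rotate \o glue] are the faces, so the last field
   is Euler's formula V - E + F = 2 for every connected component of the
   underlying graph, with V = ncross and E = 2 * ncross in total.  The relative
   position in the plane of the connected components is not recorded, as the
   Khovanov complex does not depend on it. *)
Record link_diagram := LinkDiagram {
  ncross : nat;
  nloop : nat;
  positive : pred 'I_ncross;
  glue : half_edge ncross -> half_edge ncross;
  glueK : involutive glue;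
  glue_oriented :
    forall d, outgoing positive (glue d) = ~~ outgoing positive d;
  planar :
    fcard (@rotate ncross \o glue) predT =
    (ncross + 2 * n_comp [rel c c' | [exists k, (glue (c, k)).1 == c']] predT)%N
}.

(* A point of the diagram away from the crossings, up to moving it inside a
   half-edge; [inr] is for the components without crossings. *)
Definition point (D : link_diagram) : Type :=
  (half_edge (ncross D) + 'I_(nloop D))%type.
HB.instance Definition _ D := Finite.on (point D).

Definition vertex (D : link_diagram) : Type := {ffun 'I_(ncross D) -> bool}.
HB.instance Definition _ D := Finite.on (vertex D).

(* The 0-smoothing joins the half-edges 0-1 and 2-3, the 1-smoothing joins 1-2
   and 3-0. *)
Definition smoothed (b : bool) (k l : 'I_4) : bool :=
  odd ((k + b)./2) == odd ((l + b)./2).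

Definition adjacent D (v : vertex D) : rel (point D) := fun x y =>
  match x, y with
  | inl d, inl d' =>
      (d' == glue d) || ((d.1 == d'.1) && smoothed (v d.1) d.2 d'.2)
  | _, _ => false
  end.

(* The circles of the resolution at v are the classes of [same_circle v]. *)
Definition same_circle D (v : vertex D) : rel (point D) :=
  connect (adjacent v).

(* The basis of the direct sum over v of the tensor products A_h^{(x) k}: a vertex
   v with a labelling of the circles of its resolution by the basis elements of
   A_h, i.e., a labelling of the points that is constant on circles. *)
Definition enhanced (D : link_diagram) : Type :=
  {s : vertex D * {ffun point D -> bool} |
    [forall x, forall y, same_circle s.1 x y ==> (s.2 x == s.2 y)]}.
HB.instance Definition _ D := Finite.on (enhanced D).

Definition vertex_of D (s : enhanced D) : vertex D := (val s).1.
Definition label D (s : enhanced D) (x : point D) : bool := (val s).2 x.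

Definition chains (D : link_diagram) : Type := {ffun enhanced D -> Rh^o}.
HB.instance Definition _ D := GRing.Lmodule.on (chains D).

Definition basis D (s : enhanced D) : chains D := [ffun t => (t == s)%:R].

Definition set_one D (v : vertex D) (c : 'I_(ncross D)) : vertex D :=
  [ffun c' => (c' == c) || v c'].

Definition at_crossing D (c : 'I_(ncross D)) (k : 'I_4) : point D :=
  inl (c, k).

(* The coefficient at t of the image of s under m or Delta, for an edge of the
   cube from v = vertex_of s to v' = vertex_of t changing the crossing c.  At v
   the circles through c are those of its half-edges 0 and 2, at v' those of its
   half-edges 0 and 1.  Either two circles merge (m) or one circle splits
   (Delta); as D is planar, no other case occurs when v' is [set_one v c]. *)
Definition edge_coef D (c : 'I_(ncross D)) (s t : enhanced D) : Rh :=
  let v := vertex_of s in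
  let v' := vertex_of t in
  let p0 := at_crossing c (inord 0) in
  let p1 := at_crossing c (inord 1) in
  let p2 := at_crossing c (inord 2) in
  if [forall x, ~~ same_circle v x p0 && ~~ same_circle v x p2
                ==> (label t x == label s x)]
  then if ~~ same_circle v p0 p2 && same_circle v' p0 p1
       then mulA (label s p0) (label s p2) (label t p0)
       else if same_circle v p0 p2 && ~~ same_circle v' p0 p1
       then comulA (label s p0) (label t p0) (label t p1)
       else 0
  else 0.

Definition edge_sign D (v : vertex D) (c : 'I_(ncross D)) : Rh :=
  (-1) ^+ #|[set c' : 'I_(ncross D) | (c' < c)%N && v c']|.

(* At most one c contributes to the sum. *)
Definition diff_coef D (s t : enhanced D) : Rh :=
  \sum_(c | ~~ vertex_of s c && (vertex_of t == set_one (vertex_of s) c))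
     edge_sign (vertex_of s) c * edge_coef c s t.

Definition kh_diff D (x : chains D) : chains D :=
  [ffun t => \sum_s diff_coef s t * x s].

Lemma kh_diff_is_linear D : linear (@kh_diff D).
Proof.
move=> a x y; apply/ffunP => t; rewrite !ffunE scaler_sumr -big_split /=.
apply: eq_bigr => s _; rewrite !ffunE mulrDr; congr (_ + _).
exact: mulrCA.
Qed.
HB.instance Definition _ D :=
  GRing.isLinear.Build Rh (chains D) (chains D) _ (@kh_diff D)
    (@kh_diff_is_linear D).

Definition nneg (D : link_diagram) : nat :=
  #|[set c : 'I_(ncross D) | ~~ positive c]|.
Definition npos (D : link_diagram) : nat :=
  #|[set c : 'I_(ncross D) | positive c]|.
Definition weight D (v : vertex D) : nat := #|[set c | v c]|.

Definition hdeg D (s : enhanced D) : int :=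
  (weight (vertex_of s))%:Z - (nneg D)%:Z.

(* On A_h the quantum grading is the degree shifted by -1, so that 1 and X have
   degrees -1 and 1, and m and Delta have degree 1.  With deg X = deg h = 2, this
   is the opposite of the convention where X has degree -1; the shifts by the
   weight and by the numbers of crossings are accordingly the opposite of the
   usual ones.  The circles are counted through their representatives. *)
Definition qdeg D (s : enhanced D) : int :=
  (\sum_(x | roots (adjacent (vertex_of s)) x) (if label s x then 1 else -1))
  - (weight (vertex_of s))%:Z + (nneg D)%:Z *+ 2 - (npos D)%:Z.

Definition kh_homog D (i j : int) (x : chains D) : Prop :=
  forall (s : enhanced D) (k : nat),
    (x s)`_k != 0 -> hdeg s = i /\ qdeg s + (2 * k)%:Z = j.

(* [homog i j] are the homogeneous elements of homological degree i and quantum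
   degree j.  The properties of the differential (square zero, bidegree (1, 0))
   are not part of the structure: they do not enter the notions of isomorphism,
   direct sum and shift. *)
Record complex := Complex {
  carrier :> lmodType Rh;
  diff : {linear carrier -> carrier};
  homog : int -> int -> carrier -> Prop
}.

Definition CKh (D : link_diagram) : complex :=
  @Complex (chains D) (@kh_diff D) (@kh_homog D).

Definition qshift (a : int) (C : complex) : complex :=
  @Complex C (@diff C) (fun i j => @homog C i (j - a)).

Definition dsum_diff (C C' : complex) (x : (C * C')%type) : (C * C')%type :=
  (diff C x.1, diff C' x.2).

Lemma dsum_diff_is_linear C C' : linear (@dsum_diff C C').
Proof. by move=> a x y; rewrite /dsum_diff !linearP. Qed.
HB.instance Definition _ (C C' : complex) :=
  GRing.isLinear.Build Rh (C * C')%type (C * C')%type _ (@dsum_diff C C')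
    (@dsum_diff_is_linear C C').

Definition dsum (C C' : complex) : complex :=
  @Complex (C * C')%type (@dsum_diff C C')
    (fun i j x => homog i j x.1 /\ homog i j x.2).

(* Isomorphism of C and C' regarded as bigraded complexes over the subring S of
   R_h. *)
Definition iso_over (S : Rh -> Prop) (C C' : complex) : Prop :=
  exists f : C -> C',
    [/\ bijective f,
        forall x y, f (x + y) = f x + f y,
        forall a x, S a -> f (a *: x) = a *: f x,
        forall x, f (diff C x) = diff C' (f x)
      & forall i j x, homog i j x <-> homog i j (f x)].

(* The two choices C_X and C_Y; the tensor factor at the
   marked point is X - mark_root r, i.e., X for RedX and Y = X - h for RedY. *)
Variant reduction := RedX | RedY.
Definition mark_root (r : reduction) : Rh := if r is RedX then 0 else h.

Lemma mark_root_sqr r : mark_root r * mark_root r = h * mark_root r.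
Proof. by case: r; rewrite /= ?mulr0. Qed.

Lemma adjacent_sym D (v : vertex D) : symmetric (adjacent v).
Proof.
move=> [d|?] [d'|?] //=; congr (_ || _).
  by rewrite -(inj_eq (inv_inj (@glueK D))) glueK eq_sym.
by rewrite eq_sym; case: eqP => //= ->; rewrite /smoothed eq_sym.
Qed.

Lemma same_circle_sym D (v : vertex D) : symmetric (same_circle v).
Proof. exact/sym_connect_sym/adjacent_sym. Qed.

Lemma same_circleC D (v : vertex D) x y z :
  same_circle v x y -> same_circle v x z = same_circle v y z.
Proof. by move=> xy; apply: (same_connect (@same_circle_sym D v)). Qed.

Lemma same_circleCr D (v : vertex D) x y z :
  same_circle v x y -> same_circle v z x = same_circle v z y.
Proof. by move=> xy; rewrite ![same_circle v z _]same_circle_sym (same_circleC z xy). Qed.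

Lemma label_circle D (s : enhanced D) x y :
  same_circle (vertex_of s) x y -> label s x = label s y.
Proof.
by move=> xy; apply/eqP; move/forallP/(_ x)/forallP/(_ y)/implyP: (valP s); apply.
Qed.

Definition set_label_fun D (p : point D) (b : bool) (s : enhanced D) :
    vertex D * {ffun point D -> bool} :=
  (vertex_of s,
   [ffun x => if same_circle (vertex_of s) p x then b else label s x]).

Lemma set_label_subproof D (p : point D) b (s : enhanced D) :
  [forall x, forall y, same_circle (set_label_fun p b s).1 x y
     ==> ((set_label_fun p b s).2 x == (set_label_fun p b s).2 y)].
Proof.
apply/forallP => x; apply/forallP => y; apply/implyP => /= xy.
by rewrite !ffunE (label_circle xy) (same_circleCr p xy).
Qed.

Definition set_label D (p : point D) (b : bool) (s : enhanced D) : enhanced D :=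
  exist _ (set_label_fun p b s) (set_label_subproof p b s).

(* For s with label X on the circle containing p: the element obtained from s by
   replacing this X by X - mark_root r. *)
Definition reduced_gen D (p : point D) (r : reduction) (s : enhanced D) :
    chains D :=
  basis s - mark_root r *: basis (set_label p false s).

Definition reduced_comb D (p : point D) (r : reduction)
    (a : enhanced D -> Rh) : chains D :=
  \sum_(s | label s p) a s *: reduced_gen p r s.

(* C_X or C_Y, the span of the [reduced_gen p r s]: by [reducedP], the
   coefficients of a combination of these are its own values. *)
Definition reduced D (p : point D) (r : reduction) : {pred chains D} :=
  [pred x : chains D | x == reduced_comb p r x].

Lemma label_set D (p : point D) b (s : enhanced D) x :
  label (set_label p b s) x =
  if same_circle (vertex_of s) p x then b else label s x.
Proof. by rewrite /label /= ffunE. Qed.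

Lemma label_set_mark D (p : point D) b (s : enhanced D) :
  label (set_label p b s) p = b.
Proof. by rewrite label_set /same_circle connect0. Qed.

Lemma enhanced_eq D (s t : enhanced D) :
  vertex_of s = vertex_of t -> label s =1 label t -> s = t.
Proof.
move: s t => [[v l] ls] [[v' l'] lt]; rewrite /vertex_of /label /= => vv ll.
by apply: val_inj; rewrite /= vv; congr pair; apply/ffunP.
Qed.

Lemma set_labelK D (p : point D) b c (s : enhanced D) :
  label s p = b -> set_label p b (set_label p c s) = s.
Proof.
move=> sp; apply: enhanced_eq => //= x; rewrite !label_set /=.
by case: ifP => px; rewrite -?sp ?(@label_circle _ s _ _ px) // [same_circle _ _ _]px.
Qed.

Lemma reduced_combE D (p : point D) r a (t : enhanced D) :
  reduced_comb p r a t =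
  if label t p then a t else - mark_root r * a (set_label p true t).
Proof.
rewrite /reduced_comb sum_ffunE.
case: ifP => tp.
  rewrite (bigD1 t) //= big1 => [|s /andP[sp s_neq]]; rewrite !ffunE.
    rewrite eqxx; case: eqP => [t1|_].
      by move: tp; rewrite t1 label_set_mark.
    by rewrite scaler0 subr0 addr0; exact: mulr1.
  rewrite eq_sym (negPf s_neq); case: eqP => [t1|_].
    by move: tp; rewrite t1 label_set_mark.
  by rewrite scaler0 subr0 scaler0.
rewrite (bigD1 (set_label p true t)) ?label_set_mark //=.
rewrite big1 => [|s /andP[sp s_neq]]; rewrite !ffunE.
  rewrite set_labelK // eqxx; case: eqP => [t1|_].
    by move: tp; rewrite [in X in X -> _]t1 label_set_mark.
  rewrite sub0r addr0 [X in _ *: - X](mulr1 (mark_root r)).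
  exact: mulrC.
case: (t =P s) => [t1|_]; first by rewrite t1 sp in tp.
case: eqP => [t1|_]; last by rewrite scaler0 subr0 scaler0.
by rewrite t1 set_labelK ?eqxx in s_neq.
Qed.

Lemma reducedP D (p : point D) r (x : chains D) :
  reflect (exists a, x = reduced_comb p r a) (x \in reduced p r).
Proof.
apply: (iffP eqP) => [x_red|[a ->]]; first by exists x.
by apply/ffunP => t; rewrite !reduced_combE label_set_mark; case: ifP.
Qed.

Lemma reducedE D (p : point D) r (x : chains D) :
  reflect (forall t, ~~ label t p -> x t = - mark_root r * x (set_label p true t))
          (x \in reduced p r).
Proof.
apply: (iffP eqP) => [-> t tp|x_red].
  by rewrite !reduced_combE (negPf tp) label_set_mark.
by apply/ffunP => t; rewrite reduced_combE; case: ifPn => // /x_red.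
Qed.

Lemma reduced_submod_closed D (p : point D) r : submod_closed (reduced p r).
Proof.
split=> [|a x y /reducedE x_red /reducedE y_red].
  by apply/reducedE => t _; rewrite !ffunE mulr0.
apply/reducedE => t tp; rewrite !ffunE x_red // y_red // mulrDr; congr (_ + _).
exact: mulrCA.
Qed.
HB.instance Definition _ D (p : point D) r :=
  GRing.isSubmodClosed.Build Rh (chains D) (reduced p r)
    (reduced_submod_closed p r).

Definition touches D (v : vertex D) (c : 'I_(ncross D)) (x : point D) : bool :=
  [exists k, same_circle v x (at_crossing c k)].

Section Edge.
Variables (D : link_diagram) (c : 'I_(ncross D)).

Lemma circle_sub (v v' : vertex D) x y :
  (forall c', c' != c -> v c' = v' c') -> ~~ touches v c x ->
  same_circle v' x y -> same_circle v x y.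
Proof.
move=> vv' /existsPn x_far /connectP[q + ->].
have: same_circle v x x by exact: connect0.
move: {2 3 5}x => u; elim: q u => //= z q IHq u xu /andP[uz]; apply: IHq.
apply: (connect_trans xu (connect1 _)).
case: u z uz xu => [[c1 k1]|?] [d'|?] //= /orP[->//|/andP[/eqP/= cd sm]] xu.
rewrite -cd eqxx /= vv' ?sm ?orbT //; apply: contraNneq (x_far k1) => <-.
exact: xu.
Qed.

Variable v : vertex D.
Let v' := set_one v c.

Lemma set_oneE c' : c' != c -> v' c' = v c'.
Proof. by rewrite ffunE => /negPf->. Qed.

Lemma touches_set_one x : touches v' c x = touches v c x.
Proof.
apply/idP/idP; apply: contraLR => far; apply/existsPn => k.
  apply: contraNN (existsPn far k); apply: circle_sub far => c' /set_oneE//.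
apply: contraNN (existsPn far k); apply: circle_sub far => c' /set_oneE//.
Qed.

Lemma circle_set_one x y :
  ~~ touches v c x -> same_circle v' x y = same_circle v x y.
Proof.
move=> far; apply/idP/idP; apply: circle_sub; rewrite ?touches_set_one //.
  by move=> c' /set_oneE.
by move=> c' /set_oneE.
Qed.

Let p0 := at_crossing c (inord 0).
Let p1 := at_crossing c (inord 1).
Let p2 := at_crossing c (inord 2).

Lemma circle_smoothed (u : vertex D) k l :
  smoothed (u c) k l -> same_circle u (at_crossing c k) (at_crossing c l).
Proof. by move=> kl; apply: connect1; rewrite /= eqxx kl orbT. Qed.

Lemma touches0 x :
  ~~ v c -> touches v c x = same_circle v x p0 || same_circle v x p2.
Proof.
move=> vc; apply/existsP/orP => [[k xk]|[?|?]]; [|by eexists; eassumption..].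
have [sm|sm] := boolP (smoothed (v c) k (inord 0)).
  by left; apply: connect_trans xk (circle_smoothed sm).
right; apply: connect_trans xk (circle_smoothed _).
by move: sm; rewrite (negPf vc) /smoothed !inordK //; case: k => [[|[|[|[|]]]]].
Qed.

Lemma touches1 x :
  touches v c x = same_circle v' x p0 || same_circle v' x p1.
Proof.
have vc : v' c = true by rewrite ffunE eqxx.
rewrite -touches_set_one.
apply/existsP/orP => [[k xk]|[?|?]]; [|by eexists; eassumption..].
have [sm|sm] := boolP (smoothed (v' c) k (inord 0)).
  by left; apply: connect_trans xk (circle_smoothed sm).
right; apply: connect_trans xk (circle_smoothed _).
by move: sm; rewrite vc /smoothed !inordK //; case: k => [[|[|[|[|]]]]].
Qed.

End Edge.

Lemma edge_coef_reduced D (c : 'I_(ncross D)) (p : point D) r (s t : enhanced D) :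
  ~~ vertex_of s c -> vertex_of t = set_one (vertex_of s) c ->
  label s p -> ~~ label t p ->
  edge_coef c s t - mark_root r * edge_coef c (set_label p false s) t =
  - mark_root r * (edge_coef c s (set_label p true t)
    - mark_root r * edge_coef c (set_label p false s) (set_label p true t)).
Proof.
move=> vc vt sp tp; set w := mark_root r.
have w2 := mark_root_sqr r; rewrite -/w in w2.
set s1 := set_label p false s; set t1 := set_label p true t.
have lab_s1 x : label s1 x =
    if same_circle (vertex_of s) p x then false else label s x.
  exact: label_set.
have lab_t1 x : label t1 x =
    if same_circle (vertex_of t) p x then true else label t x.
  exact: label_set.
rewrite /edge_coef /= -/s1 -/t1.
rewrite -[vertex_of s1]/(vertex_of s) -[vertex_of t1]/(vertex_of t).
set p0 := at_crossing c (inord 0).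
set p1 := at_crossing c (inord 1).
set p2 := at_crossing c (inord 2).
pose agree (s t : enhanced D) :=
  [forall x, ~~ same_circle (vertex_of s) x p0
          && ~~ same_circle (vertex_of s) x p2 ==> (label t x == label s x)].
rewrite -/(agree s t) -/(agree s1 t) -/(agree s t1) -/(agree s1 t1).
have far x : ~~ same_circle (vertex_of s) x p0
          && ~~ same_circle (vertex_of s) x p2 = ~~ touches (vertex_of s) c x.
  by rewrite (touches0 _ vc) negb_or.
have far' x : touches (vertex_of s) c x =
    same_circle (vertex_of t) x p0 || same_circle (vertex_of t) x p1.
  by rewrite vt touches1.
have agreeP (s' t' : enhanced D) : vertex_of s' = vertex_of s ->
    reflect (forall x, ~~ touches (vertex_of s) c x -> label t' x = label s' x)
      (agree s' t').
  move=> es; rewrite /agree es; apply: (iffP forallP) => H x.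
    by move=> xf; apply/eqP; move/implyP: (H x); rewrite far; apply.
  by apply/implyP; rewrite far => /H ->.
have [p_near|p_far] := boolP (touches (vertex_of s) c p); last first.
  have scE y : same_circle (vertex_of t) p y = same_circle (vertex_of s) p y.
    by rewrite vt circle_set_one.
  have -> : agree s t = false.
    by apply/negP => /agreeP-/(_ erefl p p_far); rewrite sp (negPf tp).
  have -> : agree s1 t1 = false.
    by apply/negP => /agreeP-/(_ erefl p p_far); rewrite !label_set_mark.
  have -> : agree s1 t = agree s t1.
    apply/agreeP/agreeP => // H x xf; move: (H x xf); rewrite lab_s1 lab_t1 scE.
      by case: ifP => // px; rewrite -(label_circle px) sp.
    case: ifP => // px _; rewrite -scE in px.
    by rewrite -(label_circle px) (negPf tp).
  have far_k k : same_circle (vertex_of s) p (at_crossing c k) = false.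
    by apply/negbTE; move/existsPn: p_far; apply.
  by rewrite !lab_s1 !lab_t1 !scE !far_k mulr0 subr0 sub0r mulNr.
have near_s x : ~~ touches (vertex_of s) c x ->
    same_circle (vertex_of s) p x = false.
  move=> xf; apply: contraNF xf => px; case/existsP: p_near => k pk.
  by apply/existsP; exists k; rewrite -(same_circleC _ px).
have near_t x : ~~ touches (vertex_of s) c x ->
    same_circle (vertex_of t) p x = false.
  move=> xf; apply: contraNF xf; rewrite same_circle_sym vt.
  move=> px; rewrite -touches_set_one; move: p_near; rewrite -touches_set_one.
  by case/existsP=> k pk; apply/existsP; exists k; rewrite (same_circleC _ px).
have agE (s' t' : enhanced D) : vertex_of s' = vertex_of s ->
    (forall x, ~~ touches (vertex_of s) c x -> label s' x = label s x) ->
    (forall x, ~~ touches (vertex_of s) c x -> label t' x = label t x) ->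
    agree s' t' = agree s t.
  move=> es ls lt; apply/agreeP/agreeP => // H x xf.
    by rewrite -lt // H // ls.
  by rewrite lt // H // ls.
have s1E x : ~~ touches (vertex_of s) c x -> label s1 x = label s x.
  by move=> xf; rewrite lab_s1 near_s.
have t1E x : ~~ touches (vertex_of s) c x -> label t1 x = label t x.
  by move=> xf; rewrite lab_t1 near_t.
rewrite (agE s1 t) // (agE s t1) // (agE s1 t1) //.
case: ifP => _; last by rewrite !mulr0 subrr mulr0.
rewrite mulrBr !mulNr opprK [in RHS]mulrA w2.
case: ifP => [/andP[n02 e01]|_].
  have pt0 : same_circle (vertex_of t) p p0.
    by move: p_near; rewrite far' (same_circleCr p e01) orbb.
  rewrite lab_t1 pt0 -(label_circle pt0) (negPf tp) !lab_s1.
  move: p_near; rewrite (touches0 _ vc) => /orP[ps|ps].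
    have ns : same_circle (vertex_of s) p p2 = false.
      by rewrite (same_circleC _ ps) (negPf n02).
    rewrite ps ns -(label_circle ps) sp; case: (label s p2); rewrite /mulA /=; ring.
  have ns : same_circle (vertex_of s) p p0 = false.
    by rewrite (same_circleC _ ps) same_circle_sym (negPf n02).
  rewrite ps ns -(label_circle ps) sp; case: (label s p0); rewrite /mulA /=; ring.
case: ifP => [/andP[e02 n01]|_]; last by rewrite !mulr0 subrr oppr0 addr0.
have ps0 : same_circle (vertex_of s) p p0.
  by move: p_near; rewrite (touches0 _ vc) (same_circleCr p e02) orbb.
rewrite lab_s1 ps0 -(label_circle ps0) sp !lab_t1.
move: p_near; rewrite far' => /orP[pt|pt].
  have nt : same_circle (vertex_of t) p p1 = false.
    by rewrite (same_circleC _ pt) (negPf n01).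
  rewrite pt nt -(label_circle pt) (negPf tp); case: (label t p1); rewrite /comulA /=; ring.
have nt : same_circle (vertex_of t) p p0 = false.
  by rewrite (same_circleC _ pt) same_circle_sym (negPf n01).
rewrite pt nt -(label_circle pt) (negPf tp); case: (label t p0); rewrite /comulA /=; ring.
Qed.

Lemma kh_diff_basis D (s t : enhanced D) : kh_diff (basis s) t = diff_coef s t.
Proof.
rewrite ffunE (bigD1 s) //= big1 => [|u us]; rewrite ffunE.
  by rewrite eqxx mulr1 addr0.
by rewrite (negPf us) mulr0.
Qed.

Lemma kh_diff_reduced_gen D (p : point D) r s :
  label s p -> kh_diff (reduced_gen p r s) \in reduced p r.
Proof.
move=> sp; apply/reducedE => t tp.
have dE u : kh_diff (reduced_gen p r s) u =
    diff_coef s u - mark_root r * diff_coef (set_label p false s) u.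
  by rewrite linearB linearZ /= !ffunE -!kh_diff_basis !ffunE.
rewrite !dE /diff_coef -[vertex_of (set_label p false s)]/(vertex_of s).
rewrite -[vertex_of (set_label p true t)]/(vertex_of t).
rewrite !mulr_sumr -!sumrB mulr_sumr; apply: eq_bigr => c /andP[vc /eqP vt].
rewrite ![mark_root r * (_ * _)]mulrCA -!mulrBr mulrCA.
by rewrite (edge_coef_reduced r vc vt sp tp).
Qed.

Lemma kh_diff_reduced D (p : point D) r (x : chains D) :
  x \in reduced p r -> kh_diff x \in reduced p r.
Proof.
case/reducedP=> a ->; rewrite /reduced_comb linear_sum rpred_sum // => s sp.
by rewrite linearZ rpredZ // kh_diff_reduced_gen.
Qed.

Record reduced_chains D (p : point D) (r : reduction) := ReducedChains {
  reduced_val :> chains D;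
  reduced_valP : reduced_val \in reduced p r
}.
HB.instance Definition _ D (p : point D) r :=
  [isSub of reduced_chains p r for @reduced_val D p r].
HB.instance Definition _ D (p : point D) r :=
  [Choice of reduced_chains p r by <:].
HB.instance Definition _ D (p : point D) r :=
  [SubChoice_isSubLmodule of reduced_chains p r by <:].

Definition reduced_diff D (p : point D) r (x : reduced_chains p r) :
    reduced_chains p r :=
  ReducedChains (kh_diff_reduced (reduced_valP x)).

Lemma reduced_diff_is_linear D (p : point D) r : linear (@reduced_diff D p r).
Proof. by move=> a x y; apply: val_inj; rewrite /= !linearP. Qed.
HB.instance Definition _ D (p : point D) r :=
  GRing.isLinear.Build Rh (reduced_chains p r) (reduced_chains p r) _
    (@reduced_diff D p r) (@reduced_diff_is_linear D p r).

Definition subCKh D (p : point D) (r : reduction) : complex :=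
  @Complex (reduced_chains p r) (@reduced_diff D p r)
    (fun i j x => kh_homog i j (reduced_val x)).

Definition rCKh D (p : point D) (r : reduction) : complex :=
  qshift (-1) (subCKh p r).

(* Main.v *)
(* The Z[h^2]-algebra involution h |-> -h, X |-> X - h of A_h preserves the
   counit, so it induces an involution s of the Khovanov complex, which is the
   identity modulo h; hence nu = (1 - s) / h is an endomorphism of the complex,
   of square zero.  Write M and M' for the multiplications by X and X - h (or the
   other way round) at the marked point: M M' = 0, s M = M' s, and the reduced
   complex C is the image of M.  Then x |-> (M nu x, M s x) is an isomorphism
   onto C + C with inverse (u, v) |-> u - nu (s v), up to signs. *)

From HB Require Import structures.
Require Import Defs.
From mathcomp Require Import all_boot all_order all_algebra.
From mathcomp Require Import ring zify.

Set Implicit Arguments.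
Unset Strict Implicit.
Unset Printing Implicit Defensive.

Import GRing.Theory.
Local Open Scope ring_scope.

(** * The involution h |-> -h of Z[h] *)

Definition conjh (a : Rh) : Rh := a \Po (- 'X).
HB.instance Definition _ := GRing.RMorphism.copy conjh (comp_poly (- 'X : Rh)).

Lemma conjh_h : conjh h = - h.
Proof. exact: comp_polyX. Qed.

Lemma conjhK : involutive conjh.
Proof. by move=> a; rewrite /conjh -comp_polyA linearN /= comp_polyX opprK comp_polyXr. Qed.

Lemma conjh_fixed a : Rh' a -> conjh a = a.
Proof.
by case=> r ->; rewrite /conjh -comp_polyA rmorphXn /= comp_polyX sqrrN.
Qed.

Section Chains.
Variable D : link_diagram.
Implicit Types (s t : enhanced D) (v : vertex D) (p q : point D).
Implicit Types (x y z : chains D) (r : reduction).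

(** * Pointwise evaluation of chains *)

Lemma chainsP x y : (forall t, x t = y t :> Rh) -> x = y.
Proof. by move=> xy; apply/ffunP. Qed.

Lemma chains0E t : (0 : chains D) t = 0 :> Rh.
Proof. exact: ffunE. Qed.

Lemma chainsDE x y t : (x + y) t = (x t : Rh) + (y t : Rh) :> Rh.
Proof. exact: ffunE. Qed.

Lemma chainsNE x t : (- x) t = - (x t : Rh) :> Rh.
Proof. exact: ffunE. Qed.

Lemma chainsZE a x t : (a *: x) t = a * (x t : Rh) :> Rh.
Proof. exact: ffunE. Qed.

Lemma basisE s t : basis s t = (t == s)%:R :> Rh.
Proof. exact: ffunE. Qed.

Definition chainsE := (chains0E, chainsDE, chainsNE, chainsZE, basisE).

(** Identities about [nu] are proved after multiplication by h, which turns [nu] into 1 - [conj];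
    this cancels the h. *)
Lemma scale_h_inj : injective (fun x : chains D => h *: x).
Proof.
move=> x y xy; apply: chainsP => t; have := congr1 (fun z : chains D => z t : Rh) xy.
by rewrite !chainsE; apply: mulfI; rewrite polyX_eq0.
Qed.

Lemma chains_sum_basis x : x = \sum_s x s *: basis s.
Proof.
apply/ffunP => t; rewrite sum_ffunE (bigD1 t) //= big1 => [|s st].
  by rewrite addr0 [RHS]chainsE basisE eqxx mulr1.
by rewrite [LHS]chainsE basisE eq_sym (negPf st) mulr0.
Qed.

(** * Relabelling a circle, and multiplication by X on it *)

Lemma set_label2 p b c s : set_label p b (set_label p c s) = set_label p b s.
Proof.
apply: enhanced_eq => // q; rewrite !label_set.
by rewrite -[vertex_of (set_label _ _ _)]/(vertex_of s); case: ifP => // ->.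
Qed.

Lemma set_label_id p b s : label s p = b -> set_label p b s = s.
Proof.
move=> sp; apply: enhanced_eq => // q; rewrite label_set.
by case: ifP => // pq; rewrite -sp (label_circle pq).
Qed.

(* Multiplication by X on the circle containing p. *)
Definition dot p x : chains D :=
  [ffun t => if label t p then x (set_label p false t) + h * (x t : Rh) else 0].

Lemma dotE p x t : dot p x t =
  if label t p then (x (set_label p false t) : Rh) + h * (x t : Rh) else 0 :> Rh.
Proof. exact: ffunE. Qed.

Lemma dot_is_linear p : linear (dot p).
Proof.
move=> a x y; apply: chainsP => t; rewrite !(dotE, chainsE).
by case: ifP => _; ring.
Qed.
HB.instance Definition _ p :=
  GRing.isLinear.Build Rh (chains D) (chains D) _ (dot p) (dot_is_linear p).

Lemma dot_basis p s :
  dot p (basis (set_label p false s)) = basis (set_label p true s).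
Proof.
(* The states are made opaque, as a comparison of [basis _] at different states
   by conversion takes very long. *)
have [s0 e0] : {s0 | s0 = set_label p false s} by exists (set_label p false s).
have [s1 e1] : {s1 | s1 = set_label p true s} by exists (set_label p true s).
rewrite -e0 -e1; apply: chainsP => t; rewrite dotE.
have [t0 et0] : {t0 | t0 = set_label p false t} by exists (set_label p false t).
rewrite -et0 [in RHS]basisE (basisE s0 t0) (basisE s0 t); case: ifPn => tp.
  have -> : (t == s0) = false.
    by apply/eqP => e; move: tp; rewrite e e0 label_set_mark.
  rewrite mulr0 addr0 et0 e0 e1; congr (_ %:R); congr nat_of_bool; apply/eqP/eqP.
    by move/(congr1 (set_label p true)); rewrite !set_label2 set_label_id.
  by move=> ->; rewrite set_label2.
by case: eqP => // e; move: tp; rewrite e e1 label_set_mark.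
Qed.

(** * Induction starting from the labellings by 1 *)

Lemma unit_state_subproof v :
  [forall p, forall q, same_circle (v, [ffun _ : point D => false]).1 p q
     ==> ((v, [ffun _ : point D => false]).2 p
          == (v, [ffun _ : point D => false]).2 q)].
Proof. by apply/forallP => p; apply/forallP => q; rewrite /= !ffunE eqxx implybT. Qed.

Definition unit_state v : enhanced D := exist _ (_, _) (unit_state_subproof v).

Lemma label_unit v p : label (unit_state v) p = false.
Proof. by rewrite /label /= ffunE. Qed.

(** Relabelling the circle of p by 1 removes at least p from the set of points labelled X, so the
    size of this set serves as induction measure. *)
Lemma basis_ind (P : enhanced D -> Prop) :
  (forall v, P (unit_state v)) ->
  (forall p s, label s p -> P (set_label p false s) -> P s) ->
  forall s, P s.
Proof.
move=> Punit Pdot s; have [n] := ubnP #|[set p | label s p]|.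
elim: n s => // n IHn s /ltnSE le_s.
have [/existsP[p sp]|/existsPn no] := boolP [exists p, label s p].
  apply: (Pdot p) => //; apply: IHn; apply: leq_trans le_s.
  apply: proper_card; apply/properP; split; last first.
    by exists p; rewrite !inE ?sp // label_set_mark.
  by apply/subsetP => q; rewrite !inE label_set; case: ifP.
suff -> : s = unit_state (vertex_of s) by [].
by apply: enhanced_eq => // q; rewrite label_unit; apply/negbTE/no.
Qed.

(** Every label X is created by a [dot]. So an identity of maps with known behaviour on sums,
    scalars and dots needs checking only on the units of the vertices. *)
Lemma chains_ind (P : chains D -> Prop) :
  P 0 ->
  (forall x y, P x -> P y -> P (x + y)) ->
  (forall a x, P x -> P (a *: x)) ->
  (forall v, P (basis (unit_state v))) ->
  (forall p x, P x -> P (dot p x)) ->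
  forall x, P x.
Proof.
move=> P0 PD PZ Punit Pdot x; rewrite (chains_sum_basis x).
apply: (big_ind P) => // s _; apply: PZ.
elim/basis_ind: s => [v|p s sp]; first exact: Punit.
by move=> /(Pdot p); rewrite dot_basis set_label_id.
Qed.

(** * The action of X on C_X and C_Y, and its commutation with the differential *)

Lemma dot_reducedX p x : dot p x \in reduced p RedX.
Proof. by apply/reducedE => t tp; rewrite !dotE (negPf tp) /= oppr0 mul0r. Qed.

Lemma dot_reducedY p x : dot p x - h *: x \in reduced p RedY.
Proof.
apply/reducedE => t tp; rewrite !(dotE, chainsE) (negPf tp) label_set_mark.
by rewrite /= set_label2 set_label_id; [ring | exact/negbTE].
Qed.

Lemma reducedX_dot p x : x \in reduced p RedX -> dot p x = h *: x.
Proof.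
move=> /reducedE xr; apply: chainsP => t; rewrite dotE chainsE.
case: ifPn => tp; rewrite xr ?label_set_mark //= oppr0 ?mul0r ?add0r //.
by rewrite mulr0.
Qed.

Lemma reducedY_dot p x : x \in reduced p RedY -> dot p x = 0.
Proof.
move=> /reducedE xr; apply: chainsP => t; rewrite dotE chainsE.
case: ifPn => // tp.
by rewrite xr ?label_set_mark //= set_label2 set_label_id // mulNr addNr.
Qed.

(* C_X and C_Y are subcomplexes on which X acts by h and 0, and they contain
   X z and (X - h) z; this gives the commutation up to a factor h. *)
Lemma kh_diff_dot p x : kh_diff (dot p x) = dot p (kh_diff x).
Proof.
apply: scale_h_inj => /=.
have dot_h z : dot p (h *: z) = h *: dot p z by rewrite linearZ.
rewrite -(reducedX_dot (kh_diff_reduced (dot_reducedX p x))) -dot_h.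
have := reducedY_dot (kh_diff_reduced (dot_reducedY p x)).
rewrite (linearB (@kh_diff D)) (linearB (dot p)) => /eqP.
by rewrite subr_eq0 => /eqP; rewrite (linearZ_LR (@kh_diff D)).
Qed.

(** * The semilinear involution of the chains *)

(* The coefficient of X^b in the image of X^a under X |-> X - h. *)
Definition conj_coef (a b : bool) : Rh := if a then if b then 1 else - h else (~~ b)%:R.

(** [roots] selects one point per circle, so this is an entry of the tensor power of [conj_coef],
    block diagonal over the vertices of the cube. *)
Definition conj_entry s t : Rh :=
  (vertex_of s == vertex_of t)%:R *
  \prod_(x | roots (adjacent (vertex_of t)) x) conj_coef (label s x) (label t x).

(* The automorphism h |-> -h, X |-> X - h of A_h, on every circle. *)
Definition conj x : chains D :=
  [ffun t => \sum_s conj_entry s t * conjh (x s)].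

Lemma conjE x t : conj x t = \sum_s conj_entry s t * conjh (x s) :> Rh.
Proof. exact: ffunE. Qed.

Lemma conj_is_additive : zmod_morphism conj.
Proof.
move=> x y; apply: chainsP => t; rewrite !(conjE, chainsE) -sumrB.
by apply: eq_bigr => s _; rewrite !chainsE rmorphB mulrBr.
Qed.
HB.instance Definition _ :=
  GRing.isZmodMorphism.Build (chains D) (chains D) conj conj_is_additive.

Lemma conjZ a x : conj (a *: x) = conjh a *: conj x.
Proof.
apply: chainsP => t; rewrite !(conjE, chainsE) mulr_sumr.
by apply: eq_bigr => s _; rewrite chainsE rmorphM mulrCA.
Qed.

Lemma conj_hZ x : conj (h *: x) = - (h *: conj x).
Proof. by rewrite conjZ conjh_h scaleNr. Qed.

Lemma root_label s p : label s (fingraph.root (adjacent (vertex_of s)) p) = label s p.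
Proof. by apply/esym/label_circle; exact: connect_root. Qed.

(** E is the product over the circles that avoid p. Splitting off the factor at p reduces [conj_dot]
    to a computation in a single copy of A_h. *)
Lemma conj_entry_local p : exists E : enhanced D -> enhanced D -> Rh,
  (forall s t, conj_entry s t = conj_coef (label s p) (label t p) * E s t) /\
  (forall s t b c, E (set_label p b s) (set_label p c t) = E s t).
Proof.
exists (fun s t => (vertex_of s == vertex_of t)%:R *
  \prod_(x | roots (adjacent (vertex_of t)) x && ~~ same_circle (vertex_of t) p x)
    conj_coef (label s x) (label t x)); split=> [s t|s t b c].
  rewrite /conj_entry mulrCA; case: eqP => [e|_]; last by rewrite !mul0r.
  rewrite !mul1r (bigD1 (fingraph.root (adjacent (vertex_of t)) p)) /=; last first.
    exact/roots_root/sym_connect_sym/adjacent_sym.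
  rewrite -{1}e !root_label; congr (_ * _); apply: eq_bigl => x.
  case rx: (roots _ x) => //=; congr (~~ _); rewrite /same_circle.
  rewrite -(root_connect (sym_connect_sym (@adjacent_sym _ (vertex_of t)))).
  by rewrite eq_sym (eqP rx).
rewrite /=; case: eqP => [e|_]; last by rewrite !mul0r.
rewrite !mul1r; apply: eq_bigr => x /andP[_ /negPf px].
by rewrite !label_set [vertex_of s]e px.
Qed.

Lemma sum_by_label p (F : enhanced D -> Rh) :
  \sum_s F s = \sum_(s | label s p) (F s + F (set_label p false s)).
Proof.
rewrite big_split /= (bigID (fun s => label s p)) /=; congr (_ + _).
rewrite (reindex_onto (set_label p false) (set_label p true)) /=; last first.
  by move=> s sp; rewrite set_label2 set_label_id //; apply/negbTE.
apply: eq_bigl => s; rewrite label_set_mark set_label2 /=.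
apply/eqP/idP => [<-|]; first by rewrite label_set_mark.
exact: set_label_id.
Qed.

(** The sum over s is grouped into pairs differing only on the circle of p. Both members of a pair
    share the factor E, and what remains is the action of X |-> X - h on the basis 1, X. *)
Lemma conj_dot p x : conj (dot p x) = dot p (conj x) - h *: conj x.
Proof.
have [E [entryE E_set]] := conj_entry_local p.
apply: chainsP => t; rewrite !(chainsE, dotE, conjE).
rewrite !(sum_by_label p) !mulr_sumr.
have [b tp] : {b | label t p = b} by exists (label t p).
have E1 s c : E s (set_label p c t) = E s t.
  by have := E_set s t (label s p) c; rewrite (set_label_id (erefl (label s p))).
have E2 s c : E (set_label p c s) t = E s t.
  by have := E_set s t c (label t p); rewrite (set_label_id (erefl (label t p))).
rewrite tp; case: b tp => tp; rewrite ?sub0r -?big_split /= -?sumrN -?big_split /=.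
  apply: eq_bigr => s sp; rewrite !dotE !entryE ?E1 ?E2 !label_set_mark sp tp.
  rewrite ?set_label2 ?rmorph0 ?rmorphD ?rmorphM /= conjh_h /conj_coef /=.
  ring.
apply: eq_bigr => s sp; rewrite !dotE !entryE ?E1 ?E2 !label_set_mark sp tp.
rewrite ?set_label2 ?rmorph0 ?rmorphD ?rmorphM /= conjh_h /conj_coef /=.
ring.
Qed.

Lemma conj_unit v : conj (basis (unit_state v)) = basis (unit_state v).
Proof.
apply: chainsP => t; rewrite conjE basisE (bigD1 (unit_state v)) //= big1 => [|s /negPf su].
  rewrite basisE eqxx rmorph1 mulr1 addr0 /conj_entry.
  have [->|tu] := eqVneq t (unit_state v).
    by rewrite eqxx mul1r big1 // => x _; rewrite label_unit.
  case: eqP => [e|_]; last by rewrite mul0r.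
  have [q tq] : exists q, label t q.
    apply/existsP; apply: contraNT tu => /existsPn no; apply/eqP.
    by apply: enhanced_eq => // q; rewrite label_unit; apply/negbTE/no.
  (* A circle labelled X in t contributes the coefficient of X in the image of 1, which is 0. *)
  rewrite (bigD1 (fingraph.root (adjacent (vertex_of t)) q)) /=; last first.
    exact/roots_root/sym_connect_sym/adjacent_sym.
  by rewrite root_label tq label_unit /conj_coef /= mul0r mulr0.
by rewrite basisE su rmorph0 mulr0.
Qed.

Lemma conjK : involutive conj.
Proof.
elim/chains_ind => [|x y|a x|v|p x].
- by rewrite !raddf0.
- by rewrite !raddfD => /= -> ->.
- by rewrite !conjZ conjhK => ->.
- by rewrite !conj_unit.
- move=> IH; rewrite conj_dot raddfB /= conj_hZ conj_dot IH.
  by rewrite opprK subrK.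
Qed.

(** * Division of 1 - [conj] by h *)

Lemma conj_mod_h x : exists y, x - conj x == h *: y.
Proof.
elim/chains_ind: x => [|x y|a x|v|p x].
- by exists 0; rewrite raddf0 subr0 scaler0.
- move=> [x' /eqP ex] [y' /eqP ey]; exists (x' + y').
  by rewrite raddfD /= opprD addrACA ex ey scalerDr.
- move=> [x' /eqP ex].
  have [b eb] : exists b, a - conjh a = h * b.
    (* Both a and its conjugate have the same value at h = 0. The witness below comes from writing
       the difference as a (x - [conj] x) + (a - [conjh] a) [conj] x. *)
    have : root (a - conjh a) 0.
      by rewrite /root hornerD hornerN horner_comp hornerN hornerX oppr0 subrr.
    by case/factor_theorem => b ->; exists b; rewrite subr0 mulrC.
  exists (a *: x' + b *: conj x); rewrite conjZ scalerDr !scalerA -eb.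
  by rewrite mulrC -scalerA -ex scalerBr scalerBl addrA subrK.
- by exists 0; rewrite conj_unit subrr scaler0.
- move=> [y /eqP ex]; exists (dot p y + conj x).
  by rewrite conj_dot opprB addrCA -linearB /= ex linearZ scalerDr addrC.
Qed.

(** The quotient is extracted by [xchoose], whence the boolean equality in [conj_mod_h]; it is
    unique by [scale_h_inj]. *)
Lemma nu_subproof : {f : chains D -> chains D | forall x, h *: f x = x - conj x}.
Proof.
exists (fun x => xchoose (conj_mod_h x)) => x.
by apply/esym/eqP; exact: xchooseP (conj_mod_h x).
Qed.

Definition nu : chains D -> chains D := sval nu_subproof.

Lemma h_nu x : h *: nu x = x - conj x.
Proof. exact: (svalP nu_subproof). Qed.

(** * The differential of the unit at a vertex *)

(* The labellings that can occur in the image of the unit at v under the edge at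
   c. *)
Definition unit_away v (c : 'I_(ncross D)) t :=
  [forall x, ~~ touches v c x ==> ~~ label t x].

(** After the edge, every circle through c passes through half-edge 0 or 1. Off these circles all
    labels are 1, so two labels determine the state. *)
Lemma unit_away_eq v c s t :
  vertex_of s = set_one v c -> vertex_of t = set_one v c ->
  unit_away v c s ->
  (t == s) =
  [&& unit_away v c t,
      label t (at_crossing c (inord 0)) == label s (at_crossing c (inord 0))
    & label t (at_crossing c (inord 1)) == label s (at_crossing c (inord 1))].
Proof.
move=> vs vt s_away; apply/eqP/and3P => [->|[/forallP t_away /eqP e0 /eqP e1]].
  by rewrite !eqxx.
apply: enhanced_eq => [|x]; first by rewrite vt vs.
have [|far] := boolP (touches v c x); last first.
  have := implyP (t_away x) far; have := implyP (forallP s_away x) far.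
  by move=> /negPf-> /negPf->.
have lab u q : vertex_of u = set_one v c -> same_circle (set_one v c) x q ->
    label u x = label u q.
  by move=> vu xq; apply: label_circle; rewrite vu.
by rewrite touches1 => /orP[] sx; rewrite (lab t _ vt sx) (lab s _ vs sx).
Qed.

Lemma unit_unit_away v c v' : unit_away v c (unit_state v').
Proof. by apply/forallP => x; rewrite label_unit implybT. Qed.

Lemma set_label_unit_away v c b k :
  unit_away v c (set_label (at_crossing c k) b (unit_state (set_one v c))).
Proof.
apply/forallP => x; apply/implyP => far; rewrite label_set label_unit.
case: ifP => // kx; case/negP: far; rewrite -touches_set_one.
by apply/existsP; exists k; rewrite same_circle_sym.
Qed.

Lemma dot_unit p v :
  dot p (basis (unit_state v)) = basis (set_label p true (unit_state v)).
Proof. by rewrite -dot_basis set_label_id // label_unit. Qed.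

Lemma split_unitE s0 s1 s t :
  (basis s0 + basis s1 - h *: basis s) t =
  (t == s0)%:R + (t == s1)%:R - h * (t == s)%:R :> Rh.
Proof.
rewrite 2!chainsDE chainsNE chainsZE.
by congr (_ + _ - _ * _); apply: basisE.
Qed.

(** The second branch is Delta(1). Writing it with [dot] and the unit makes [conj_dot] and
    [conj_unit] applicable. *)
Definition edge_unit v (c : 'I_(ncross D)) : chains D :=
  let e := basis (unit_state (set_one v c)) in
  let p0 := at_crossing c (inord 0) in
  let p1 := at_crossing c (inord 1) in
  let p2 := at_crossing c (inord 2) in
  if ~~ same_circle v p0 p2 && same_circle (set_one v c) p0 p1 then e
  else if same_circle v p0 p2 && ~~ same_circle (set_one v c) p0 p1
  then dot p0 e + dot p1 e - h *: e
  else 0.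

Lemma edge_unit_vertex v c t : vertex_of t != set_one v c -> edge_unit v c t = 0.
Proof.
move=> vt; have e0 b q :
    (t == set_label q b (unit_state (set_one v c))) = false.
  by apply: contraNF vt => /eqP->.
have u0 : (t == unit_state (set_one v c)) = false.
  by apply: contraNF vt => /eqP->.
rewrite /edge_unit; case: ifP => _; first by rewrite basisE u0.
case: ifP => _; last exact: chains0E.
by rewrite !dot_unit split_unitE !e0 u0 mulr0 subr0 addr0.
Qed.

Lemma edge_coef_unit v c t : ~~ v c -> vertex_of t = set_one v c ->
  edge_coef c (unit_state v) t = edge_unit v c t.
Proof.
move=> vc vt; rewrite /edge_coef /edge_unit vt -[vertex_of (unit_state v)]/v.
set p0 := at_crossing c (inord 0); set p1 := at_crossing c (inord 1).
set p2 := at_crossing c (inord 2).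
have -> : [forall x, ~~ same_circle v x p0 && ~~ same_circle v x p2
    ==> (label t x == label (unit_state v) x)] = unit_away v c t.
  by apply: eq_forallb => x; rewrite label_unit touches0 // negb_or eqbF_neg.
have unitE := @unit_away_eq v c (unit_state (set_one v c)) t erefl vt
  (unit_unit_away v c _).
have labE q := @unit_away_eq v c (set_label q true (unit_state (set_one v c))) t
  erefl vt.
have [/andP[n02 e01]|_] :=
    boolP (~~ same_circle v p0 p2 && same_circle (set_one v c) p0 p1).
  rewrite basisE unitE !label_unit /mulA /=.
  (* After a merge the half-edges 0 and 1 lie on one circle, so the two label conditions
     coincide. *)
  rewrite -(label_circle (_ : same_circle (vertex_of t) p0 p1)) ?vt // andbb.
  by case: (unit_away v c t).
have [/andP[e02 n01]|_] :=
    boolP (same_circle v p0 p2 && ~~ same_circle (set_one v c) p0 p1); last first.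
  by rewrite chains0E; case: ifP.
rewrite !dot_unit split_unitE unitE !labE ?set_label_unit_away // !label_set_mark.
rewrite !label_set !label_unit -[vertex_of _]/(set_one v c).
rewrite [same_circle _ p1 p0]same_circle_sym (negPf n01).
case: (unit_away v c t); case: (label t p0); case: (label t p1);
  rewrite /comulA /=; ring.
Qed.

Lemma kh_diff_unit v :
  kh_diff (basis (unit_state v)) =
  \sum_(c | ~~ v c) edge_sign v c *: edge_unit v c.
Proof.
apply: chainsP => t; rewrite kh_diff_basis sum_ffunE /diff_coef.
(* The condition on the target vertex moves into the summand, since [edge_unit] vanishes at the
   other vertices. *)
rewrite big_mkcondr; apply: eq_bigr => c vc; rewrite -[vertex_of (unit_state v)]/v.
rewrite [RHS]chainsZE; case: eqP => [vt|/eqP vt]; first by rewrite edge_coef_unit.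
by rewrite edge_unit_vertex // mulr0.
Qed.

(** For a split, with X and X' the actions on the two new circles: (X - h) + (X' - h) + h = X + X' -
    h. *)
Lemma conj_edge_unit v c : conj (edge_unit v c) = edge_unit v c.
Proof.
rewrite /edge_unit; case: ifP => _; first exact: conj_unit.
case: ifP => _; last exact: raddf0.
rewrite raddfB raddfD /= !conj_dot conj_hZ conj_unit opprK.
by rewrite -addrA subrK addrAC.
Qed.

(** The differential commutes with scalars and dots, which reduces the claim to units; there the
    edge signs are integers and [conj_edge_unit] applies. *)
Lemma conj_kh_diff x : conj (kh_diff x) = kh_diff (conj x).
Proof.
elim/chains_ind: x => [|x y IHx IHy|a x IH|v|p x IH].
- by rewrite !raddf0.
- rewrite (raddfD (@kh_diff D)) !(raddfD conj) /= (raddfD (@kh_diff D)).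
  by rewrite IHx IHy.
- by rewrite (linearZ_LR (@kh_diff D)) !conjZ (linearZ_LR (@kh_diff D)) /= IH.
- rewrite conj_unit kh_diff_unit raddf_sum; apply: eq_bigr => c _.
  by rewrite /= conjZ conj_edge_unit /edge_sign rmorphXn rmorphN1.
- rewrite kh_diff_dot !conj_dot IH (linearB (@kh_diff D)) /= kh_diff_dot.
  by rewrite (linearZ_LR (@kh_diff D)).
Qed.

(** * Properties of [nu] *)

Lemma nuD x y : nu (x + y) = nu x + nu y.
Proof.
by apply: scale_h_inj; rewrite /= scalerDr !h_nu (raddfD conj) opprD addrACA.
Qed.

(** This is where the scalars get restricted to Z[h^2]: [nu] is a twisted derivation over Z[h]. *)
Lemma nuZ a x : conjh a = a -> nu (a *: x) = a *: nu x.
Proof.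
move=> aa; apply: scale_h_inj; rewrite /= h_nu conjZ aa -scalerBr -h_nu.
by rewrite !scalerA mulrC.
Qed.

Lemma kh_diff_nu x : kh_diff (nu x) = nu (kh_diff x).
Proof.
apply: scale_h_inj; rewrite /= -(linearZ_LR (@kh_diff D)) !h_nu.
by rewrite (linearB (@kh_diff D)) /= conj_kh_diff.
Qed.

(** [conj] negates both h and 1 - [conj], hence fixes the quotient. *)
Lemma conj_nu x : conj (nu x) = nu x.
Proof.
apply: oppr_inj; apply: scale_h_inj; rewrite /= !scalerN -conj_hZ !h_nu.
by rewrite (raddfB conj) /= conjK opprB.
Qed.

Lemma nu_nu x : nu (nu x) = 0.
Proof. by apply: scale_h_inj; rewrite /= h_nu conj_nu subrr scaler0. Qed.

Lemma scaleAC (a b : Rh) x : a *: (b *: x) = b *: (a *: x).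
Proof. by rewrite !scalerA mulrC. Qed.

(** * Multiplication by X and X - h at the marked point *)

Definition flip r := if r is RedX then RedY else RedX.

(** The sign in X - (X - h) = h and (X - h) - X = -h. *)
Definition mark_sign r : Rh := if r is RedX then 1 else -1.

Lemma conjh_mark_sign r : conjh (mark_sign r) = mark_sign r.
Proof. by case: r; rewrite ?rmorphN1 ?rmorph1. Qed.

Lemma mark_signK r x : mark_sign r *: (mark_sign r *: x) = x.
Proof. by case: r; rewrite /= ?scaleN1r ?scale1r ?opprK. Qed.

Definition mark p r x : chains D := dot p x - mark_root r *: x.

Lemma mark_is_linear p r : linear (mark p r).
Proof.
move=> a x y; rewrite /mark linearP scalerDr opprD addrACA scalerBr.
by rewrite !scalerA mulrC.
Qed.
HB.instance Definition _ p r :=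
  GRing.isLinear.Build Rh (chains D) (chains D) _ (mark p r) (mark_is_linear p r).

Lemma mark_reduced p r x : mark p r x \in reduced p r.
Proof.
case: r; last exact: dot_reducedY.
by rewrite /mark scale0r subr0 dot_reducedX.
Qed.

Lemma flip_mark_reduced p r x : x \in reduced p r -> mark p (flip r) x = 0.
Proof.
case: r => xr; rewrite /mark /=; first by rewrite reducedX_dot ?subrr.
by rewrite reducedY_dot // scale0r subr0.
Qed.

Lemma mark_flip p r x :
  mark p r x - mark p (flip r) x = h *: (mark_sign r *: x).
Proof.
rewrite /mark opprB addrC addrA subrK -scalerBl scalerA.
by case: r => /=; rewrite ?subr0 ?sub0r ?mulr1 ?mulrN1.
Qed.

(** The opposite multiplication vanishes on the reduced subcomplex because X (X - h) = 0, so only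
    the difference of the two, h up to sign, remains. *)
Lemma mark_id p r x : x \in reduced p r -> mark p r x = h *: (mark_sign r *: x).
Proof. by move=> xr; rewrite -(mark_flip p) (flip_mark_reduced xr) subr0. Qed.

Lemma kh_diff_mark p r x : kh_diff (mark p r x) = mark p r (kh_diff x).
Proof.
by rewrite (linearB (@kh_diff D)) /= (linearZ_LR (@kh_diff D)) kh_diff_dot.
Qed.

Lemma conj_mark p r x : conj (mark p r x) = mark p (flip r) (conj x).
Proof.
rewrite raddfB /= conj_dot conjZ.
by case: r; rewrite /mark /= ?rmorph0 ?conjh_h ?scale0r ?subr0 // scaleNr opprK subrK.
Qed.

(** * The splitting maps and their inverse *)

Section Splitting.
Variables (p : point D) (r : reduction).
Let e := mark_sign r.

(** The sign e compensates the one in [mark_id], so that [split1] restricts to the identity on the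
    reduced subcomplex. *)
Definition split1 x : chains D := e *: mark p r (nu x).
Definition split2 x : chains D := mark p r (conj x).
Definition unsplit x y : chains D := x - e *: nu (conj y).

Lemma h_mark_nu x : h *: mark p r (nu x) = mark p r (x - conj x).
Proof. by rewrite -h_nu linearZ. Qed.

Lemma h_split1 x : h *: split1 x = e *: mark p r (x - conj x).
Proof. by rewrite /split1 scaleAC h_mark_nu. Qed.

Lemma split1_reduced_id x : x \in reduced p r -> split1 x = x.
Proof.
move=> xr; apply: scale_h_inj; rewrite /= h_split1 (linearB (mark p r)) /=.
(* [conj] exchanges C_X and C_Y, and each multiplication kills the opposite subcomplex. *)
have -> : mark p r (conj x) = 0.
  by apply: (inv_inj conjK); rewrite conj_mark conjK raddf0 flip_mark_reduced.
by rewrite subr0 mark_id // scaleAC mark_signK.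
Qed.

Lemma split2_reduced x : x \in reduced p r -> split2 x = 0.
Proof.
move=> xr; apply: (inv_inj conjK).
by rewrite conj_mark conjK raddf0 flip_mark_reduced.
Qed.

Lemma split1_unsplit x y : x \in reduced p r -> split1 (unsplit x y) = x.
Proof.
move=> xr; rewrite /unsplit -scaleNr /split1 nuD nuZ; last first.
  by rewrite rmorphN; congr (- _); exact: conjh_mark_sign.
by rewrite nu_nu scaler0 addr0; exact: split1_reduced_id.
Qed.

Lemma split2_unsplit x y :
  x \in reduced p r -> y \in reduced p r -> split2 (unsplit x y) = y.
Proof.
move=> xr yr; rewrite /split2 raddfB (linearB (mark p r)) /= -/(split2 x) split2_reduced //.
rewrite sub0r conjZ conjh_mark_sign conj_nu (linearZ_LR (mark p r)) /= -scalerN.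
(* Times h, the remaining term is -e M ([conj] y - y) with M = [mark p r]. Here M kills [conj] y and
   multiplies y by e h, leaving h y. *)
apply: scale_h_inj => /=; rewrite scaleAC scalerN h_mark_nu conjK (linearB (mark p r)) /=.
rewrite -[mark p r (conj y)]/(split2 y) split2_reduced //.
by rewrite sub0r opprK mark_id // scaleAC mark_signK.
Qed.

(** With M = [mark p r] and M' = [mark p (flip r)], h times the left side is e (M x - M ([conj] x))
    - e (M' x - M ([conj] x)) = e (M x - M' x) = h x. *)
Lemma unsplit_split x : unsplit (split1 x) (split2 x) = x.
Proof.
rewrite /unsplit; apply: scale_h_inj; rewrite /= scalerBr h_split1.
rewrite [h *: (e *: nu _)]scaleAC h_nu conjK -scalerBr (linearB (mark p r)) /= /split2.
rewrite conj_mark conjK.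
have <- : e *: (mark p r x - mark p (flip r) x) = h *: x.
  by rewrite mark_flip scaleAC mark_signK.
congr (e *: _); move: (mark p r x) (mark p r (conj x)) (mark p (flip r) x).
by move=> a b c; rewrite opprB addrA subrK.
Qed.

End Splitting.

(** * Homogeneity of the maps *)

Lemma kh_homog0 (i j : int) : kh_homog i j (0 : chains D).
Proof. by move=> s k; rewrite chains0E coef0 eqxx. Qed.

Lemma kh_homogD (i j : int) x y : kh_homog i j x -> kh_homog i j y -> kh_homog i j (x + y).
Proof.
move=> hx hy s k; rewrite chainsDE coefD.
by have [/hx//|] := boolP ((x s)`_k != 0); rewrite negbK => /eqP->; rewrite add0r => /hy.
Qed.

(** The degrees are constrained only by nonzero coefficients of a. Thus a homogeneous chain can be
    expanded over the whole basis: basis elements of the wrong degree have coefficient 0. *)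
Lemma kh_homogZ (i j i' j' : int) (a : Rh) x :
  (forall k, a`_k != 0 -> i' = i /\ j' + (2 * k)%:Z = j) ->
  kh_homog i' j' x -> kh_homog i j (a *: x).
Proof.
move=> ha hx s k; rewrite chainsZE coefM.
have [/existsP[l /andP[/ha[ii jj] /hx[is_ js]]] _|/existsPn no] :=
    boolP [exists l : 'I_k.+1, (a`_l != 0) && ((x s)`_(k - l) != 0)].
  by split; [rewrite is_ | have := ltn_ord l; lia].
rewrite big1 ?eqxx // => l _; have := no l; rewrite negb_and !negbK.
by case/orP => /eqP ->; rewrite ?mul0r ?mulr0.
Qed.

Lemma kh_homogN (i j : int) x : kh_homog i j x -> kh_homog i j (- x).
Proof. by move=> hx s k; rewrite chainsNE coefN oppr_eq0 => /hx. Qed.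

Lemma kh_homog_hK (i j : int) x : kh_homog i (j + 2) (h *: x) -> kh_homog i j x.
Proof.
move=> hx s k xsk; have := hx s k.+1; rewrite chainsZE coefXM /= => /(_ xsk)[-> e].
by split=> //; lia.
Qed.

Lemma kh_homog_h (i j : int) x : kh_homog i j x -> kh_homog i (j + 2) (h *: x).
Proof.
by move=> hx; apply: kh_homogZ hx => k; rewrite coefX; case: (eqVneq k 1) => [->|]; rewrite ?eqxx.
Qed.

Lemma kh_homog_sign (i j : int) r x : kh_homog i j (mark_sign r *: x) <-> kh_homog i j x.
Proof.
have H y : kh_homog i j y -> kh_homog i j (mark_sign r *: y).
  by case: r; rewrite ?scale1r ?scaleN1r //; exact: kh_homogN.
by split=> [/H|/H//]; rewrite mark_signK.
Qed.

Lemma qdeg_set_label p t :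
  label t p -> qdeg t = qdeg (set_label p false t) + 2.
Proof.
move=> tp; rewrite /qdeg -[vertex_of (set_label p false t)]/(vertex_of t).
have rp : roots (adjacent (vertex_of t)) (fingraph.root (adjacent (vertex_of t)) p).
  exact/roots_root/sym_connect_sym/adjacent_sym.
rewrite (bigD1 _ rp) [in RHS](bigD1 _ rp) /= root_label tp.
have -> : label (set_label p false t) (fingraph.root (adjacent (vertex_of t)) p) = false.
  by rewrite label_set /same_circle connect_root.
(* Only the representative of the circle of p changes its contribution, from 1 to -1. *)
rewrite [in RHS](eq_bigr (fun q => if label t q then 1 else -1)); first by ring.
move=> q /andP[rq qp]; rewrite label_set.
have [pq|//] := boolP (same_circle (vertex_of t) p q).
case/negP: qp; rewrite -(eqP rq) eq_sym.
by rewrite (root_connect (sym_connect_sym (@adjacent_sym _ (vertex_of t)))).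
Qed.

Lemma kh_homog_dot p i j x : kh_homog i j x -> kh_homog i (j + 2) (dot p x).
Proof.
move=> hx s k; rewrite dotE; case: ifP => [sp|_]; last by rewrite coef0 eqxx.
have hhx := kh_homog_h hx; rewrite coefD -chainsZE.
have [/hhx//|] := boolP (((h *: x) s)`_k != 0); rewrite negbK => /eqP->.
rewrite addr0 => /hx[<- <-]; split=> //; rewrite (qdeg_set_label sp); ring.
Qed.

Lemma kh_homog_mark p r i j x :
  kh_homog i j x -> kh_homog i (j + 2) (mark p r x).
Proof.
move=> hx; apply: kh_homogD; first exact: kh_homog_dot.
apply: kh_homogN; case: r; last exact: kh_homog_h.
by rewrite scale0r; exact: kh_homog0.
Qed.

Lemma coef_conjh (a : Rh) k : (conjh a)`_k = (-1) ^+ k * a`_k.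
Proof.
rewrite /conjh comp_polyE coef_sum.
under eq_bigr => l _ do rewrite -scaleN1r exprZn !coefZ coefXn.
have [ka|ka] := ltnP k (size a); last first.
  rewrite [a`_k]nth_default // mulr0 big1 // => l _.
  by rewrite gtn_eqF ?mulr0 // (leq_trans (ltn_ord l)).
rewrite (bigD1 (Ordinal ka)) //= eqxx mulr1 mulrC big1 ?addr0 // => l lk.
by rewrite eq_sym -val_eqE /= in lk; rewrite (negPf lk) !mulr0.
Qed.

Lemma kh_homog_basis s : kh_homog (hdeg s) (qdeg s) (basis s).
Proof.
move=> t k; rewrite basisE; case: (t =P s) => [->|_]; last by rewrite coef0 eqxx.
by rewrite coef1; case: (eqVneq k 0) => [->|]; rewrite ?eqxx // addr0.
Qed.

(** Each label X becomes X - h, homogeneous of the same degree 2. *)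
Lemma kh_homog_conj_basis s : kh_homog (hdeg s) (qdeg s) (conj (basis s)).
Proof.
elim/basis_ind: s => [v|p s sp IH]; first by rewrite conj_unit; exact: kh_homog_basis.
rewrite -{3}(set_label_id sp) -dot_basis conj_dot (qdeg_set_label sp).
by apply: kh_homogD; [exact: kh_homog_dot | exact/kh_homogN/kh_homog_h].
Qed.

Lemma kh_homog_conj i j x : kh_homog i j x -> kh_homog i j (conj x).
Proof.
move=> hx; rewrite (chains_sum_basis x) raddf_sum.
apply: (big_ind (@kh_homog D i j)) => [||s _]; [exact: kh_homog0 | exact: kh_homogD |].
rewrite /= conjZ; apply: kh_homogZ (@kh_homog_conj_basis s) => k.
rewrite coef_conjh mulf_eq0 negb_or => /andP[_]; exact: hx.
Qed.

Lemma kh_homog_nu i j x : kh_homog i (j + 2) x -> kh_homog i j (nu x).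
Proof.
move=> hx; apply: kh_homog_hK; rewrite h_nu.
by apply: kh_homogD => //; exact/kh_homogN/kh_homog_conj.
Qed.

End Chains.

(** * Assembly of the isomorphism *)

Theorem theorem2p8 (D : link_diagram) (p : point D) (r : reduction) :
  exists a b : int,
    iso_over Rh' (CKh D) (dsum (qshift a (rCKh p r)) (qshift b (rCKh p r))).
Proof.
have split1_red x : split1 p r x \in reduced p r.
  by rewrite rpredZ // mark_reduced.
(* [nu] lowers the quantum degree by 2 and [mark] raises it by 2, so the components have degrees 0
   and 2. Together with the shift by -1 inside [rCKh], this gives the shifts 1 and -1. *)
pose f (x : CKh D) : dsum (qshift 1 (rCKh p r)) (qshift (-1) (rCKh p r)) :=
  (ReducedChains (split1_red x), ReducedChains (mark_reduced p r (conj x))).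
have fP x y : reduced_val (f x).1 = reduced_val y.1 ->
    reduced_val (f x).2 = reduced_val y.2 -> f x = y.
  by case: y => [y1 y2] /= e1 e2; congr pair; apply: val_inj.
exists 1, (-1), f; split.
- exists (fun y => unsplit r (reduced_val y.1) (reduced_val y.2)) => [x|[x y]].
    exact: unsplit_split.
  apply: fP => /=.
    by rewrite split1_unsplit // reduced_valP.
  by apply: split2_unsplit; apply: reduced_valP.
- move=> x y; apply: fP => /=.
    by rewrite /split1 nuD (linearD (mark p r)) scalerDr.
  by rewrite (raddfD (@conj D)) (linearD (mark p r)).
- move=> a x /conjh_fixed aa; apply: fP => /=.
    by rewrite /split1 nuZ // (linearZ_LR (mark p r)) scaleAC.
  by rewrite conjZ aa (linearZ_LR (mark p r)).
- move=> x; apply: fP => /=.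
    by rewrite /split1 -kh_diff_nu -kh_diff_mark (linearZ_LR (@kh_diff D)).
  by rewrite conj_kh_diff kh_diff_mark.
move=> i j x; split=> [hx|[/= h1 h2]].
  have jE : j - -1 - -1 = j + 2 by ring.
  split; rewrite /= ?jE; last exact/kh_homog_mark/kh_homog_conj.
  rewrite -addrA subrr addr0; apply/kh_homog_sign.
  have -> : j = j - 2 + 2 by rewrite subrK.
  by apply/kh_homog_mark/kh_homog_nu; rewrite subrK.
(* Conversely, x is recovered from its two components by the inverse map, whose terms have degrees 0
   and -2. *)
rewrite -(unsplit_split p r x); apply: kh_homogD.
  by move: h1; rewrite -addrA subrr addr0.
apply/kh_homogN/kh_homog_sign/kh_homog_nu/kh_homog_conj.
by move: h2; have -> : j - -1 - -1 = j + 2 by ring.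
Qed.
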